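(* Let $X$ be a complex Banach space and $\{U_h\}\in C_b((0,1],B(X))$. Then $\{U_h\}$ is an asymptotic quasinilpotent operator, i.e. $\lim_{n\to\infty}\big(\limsup_{h\to0}\|U_h^n\|\big)^{1/n}=0$, if and only if $Sp(\{U_h\})=\{0\}$.
   Context: $B(X)$ is the algebra of bounded linear operators on $X$. $C_b((0,1],B(X))$ denotes the set of families $\{T_h\}_{h\in(0,1]}\subset B(X)$ with $\sup_h\|T_h\|<\infty$. The resolvent set of $\{U_h\}$ is $r(\{U_h\})=\{\lambda\in\mathbb{C}:\ \exists\{\mathcal{R}(\lambda,U_h)\}\in C_b((0,1],B(X))$ with $\lim_{h\to0}\|(\lambda I-U_h)\mathcal{R}(\lambda,U_h)-I\|=\lim_{h\to0}\|\mathcal{R}(\lambda,U_h)(\lambda I-U_h)-I\|=0\}$, and the spectrum is $Sp(\{U_h\})=\mathbb{C}\setminus r(\{U_h\})$.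
   Formalization: The Banach space X is assumed to be nonzero; for X = {0} every family is asymptotically quasinilpotent while its spectrum is empty, so the equivalence fails there. *)

(* Defs.v *)
From HB Require Import structures.
From mathcomp Require Import all_boot all_order all_algebra.
From mathcomp Require Import all_classical all_reals all_analysis.
From mathcomp Require Import complex.
Set Implicit Arguments. Unset Strict Implicit. Unset Printing Implicit Defensive.
Import Order.TTheory GRing.Theory Num.Theory.
Import numFieldNormedType.Exports.
Local Open Scope classical_set_scope.
Local Open Scope ring_scope.

(* X is a complex normed space: a normedModType over C = R[i].
   The norm of x : X is a (real) element of C; rnorm x is its real part, in R. *)
Definition rnorm (R : realType) (X : normedModType R[i]) (x : X) : R :=
  complex.Re `|x|.

Definition bounded_op (R : realType) (X : normedModType R[i]) (T : X -> X) : Prop :=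
  (forall (a : R[i]) (x y : X), T (a *: x + y) = a *: T x + T y) /\
  exists M : R, forall x : X, rnorm (T x) <= M * rnorm x.

Definition opnorm (R : realType) (X : normedModType R[i]) (T : X -> X) : R :=
  sup [set rnorm (T x) | x in [set x : X | rnorm x <= 1]].

Definition oppow (R : realType) (X : normedModType R[i]) (T : X -> X) (n : nat) : X -> X :=
  iter n T.

(* {T_h} \in C_b((0,1], B(X)) : the family is indexed by h : R, only h in (0,1] matter *)
Definition Cb (R : realType) (X : normedModType R[i]) (T : R -> X -> X) : Prop :=
  (forall h : R, 0 < h <= 1 -> bounded_op (T h)) /\
  exists M : R, forall h : R, 0 < h <= 1 -> opnorm (T h) <= M.

Definition asymp_quasinilpotent (R : realType) (X : normedModType R[i])
    (U : R -> X -> X) : Prop :=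
  (fun n : nat =>
     (fine (limf_esup (fun h : R => (opnorm (oppow (U h) n))%:E) (0 : R)^'+))
       `^ (n%:R^-1)) @ \oo --> (0 : R).

Definition resolvent_set (R : realType) (X : normedModType R[i])
    (U : R -> X -> X) : set R[i] :=
  [set lam : R[i] | exists Rl : R -> X -> X,
     Cb Rl /\
     (fun h : R => opnorm (fun x => lam *: Rl h x - U h (Rl h x) - x)) @ (0 : R)^'+
        --> (0 : R) /\
     (fun h : R => opnorm (fun x => Rl h (lam *: x - U h x) - x)) @ (0 : R)^'+
        --> (0 : R)].

Definition spectrum (R : realType) (X : normedModType R[i]) (U : R -> X -> X) : set R[i] :=
  ~` resolvent_set U.

(* Main.v *)
(* Neumann series for a complete [X] show that [lam] lies in the resolvent set
   iff, for small [h], [lam I - U_h] has an exact inverse whose norm is bounded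
   independently of [h].  If [U] is asymptotically quasinilpotent and [lam <> 0],
   such an inverse comes from the geometric sum of [U_h / lam]; for [lam = 0] a
   bounded inverse would bound [|U_h^n|^(1/n)] away from [0].

   Conversely, suppose the spectrum is [{0}].  By compactness, on each disc
   [|z| <= B] and for small [h], the operators [1 - z U_h] have inverses bounded
   by some [M].  Averaging [(1 - z U_h)^-1] over the [2^n]-th roots of unity gives
   [(1 - z^N U_h^N)^-1] with [N = 2^n], with a Lipschitz constant in [z] that does
   not depend on [n].  Hence, if [s^N |U_h^N|] is small for some [N], the same
   holds for [s + d] and [2 N], with a step [d] independent of [s]; starting from
   [s = 0], finitely many steps reach [s = B].  This replaces the usual appeal to
   Cauchy's estimates in the spectral radius formula. *)

Require Import Defs.
From HB Require Import structures.
From mathcomp Require Import all_boot all_order all_algebra.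
From mathcomp Require Import all_classical all_reals all_analysis.
From mathcomp Require Import complex lra.
Import Order.TTheory GRing.Theory Num.Theory.
Import numFieldNormedType.Exports.
Import ComplexField.Normc.
Set Implicit Arguments.
Unset Strict Implicit.
Unset Printing Implicit Defensive.
Local Open Scope classical_set_scope.
Local Open Scope ring_scope.

(** * Real-valued norm on [X] and modulus of complex numbers *)

Section rnorm_theory.
Context {R : realType} {X : normedModType R[i]}.
Implicit Types (x y : X) (z : R[i]).

Lemma norm_normc (z : R[i]) : `|z| = (normc z)%:C%C.
Proof. by []. Qed.

Lemma rnormE x : `|x| = (rnorm x)%:C%C.
Proof. by rewrite RRe_real// normr_real. Qed.

Lemma rnorm_ge0 x : 0 <= rnorm x.
Proof. by rewrite -lecR -rnormE; exact: normr_ge0. Qed.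

Lemma rnorm0 : rnorm (0 : X) = 0.
Proof. by rewrite /rnorm normr0. Qed.

Lemma rnorm_eq0 x : (rnorm x == 0) = (x == 0).
Proof. by rewrite -[RHS]normr_eq0 rnormE (inj_eq (@complexI R) _ 0). Qed.

Lemma rnormD x y : rnorm (x + y) <= rnorm x + rnorm y.
Proof. by rewrite -lecR -rnormE rmorphD/= -!rnormE ler_normD. Qed.

Lemma rnormN x : rnorm (- x) = rnorm x.
Proof. by rewrite /rnorm normrN. Qed.

Lemma rnormZ z x : rnorm (z *: x) = normc z * rnorm x.
Proof. by apply: complexI; rewrite -rnormE normrZ rmorphM/= rnormE. Qed.

End rnorm_theory.

Section normc_theory.
Context {R : realType}.

Lemma normc_ge0 (z : R[i]) : 0 <= normc z.
Proof. by rewrite -lecR -norm_normc; exact: normr_ge0. Qed.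

Lemma normc_real (r : R) : 0 <= r -> normc r%:C%C = r.
Proof. by move=> r0; rewrite /normc/= expr0n/= addr0 sqrtr_sqr ger0_norm. Qed.

Lemma normc_le_ReIm (z : R[i]) :
  normc z <= `|complex.Re z| + `|complex.Im z|.
Proof.
case: z => x y /=; rewrite -(@ler_pXn2r _ 2) ?nnegrE ?addr_ge0 ?sqrtr_ge0//.
rewrite sqr_sqrtr ?addr_ge0 ?sqr_ge0// sqrrD !real_normK ?num_real//.
by rewrite addrAC lerDl mulrn_wge0// mulr_ge0.
Qed.

Lemma ReIm_le_normc (z : R[i]) :
  `|complex.Re z| <= normc z /\ `|complex.Im z| <= normc z.
Proof.
case: z => x y /=; rewrite -!sqrtr_sqr !ler_wsqrtr//.
  by rewrite lerDr sqr_ge0.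
by rewrite lerDl sqr_ge0.
Qed.

End normc_theory.

(** * The ring of bounded operators *)

Definition is_bop {R : realType} (X : normedModType R[i]) : {pred X -> X} :=
  fun T => `[< bounded_op T >].
Arguments is_bop {R} X.

(** Bundling turns operators into a ring with composition as product, which gives access to the
    general theory of powers, sums and commuting elements. *)
Record bop {R : realType} (X : normedModType R[i]) :=
  Bop { bop_val :> X -> X; bop_valP : bop_val \in is_bop X }.

Section bop_algebra.
Context {R : realType} {X : normedModType R[i]}.
Notation A := (bop X).

HB.instance Definition _ := [isSub for @bop_val R X].
HB.instance Definition _ := [Choice of A by <:].

Lemma is_bop_submod : subsemimod_closed (is_bop X).
Proof.
apply: GRing.submod_closed_semi; split.
  apply/asboolP; split; first by move=> a x y; rewrite /= scaler0 addr0.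
  by exists 0 => x; rewrite rnorm0 mul0r.
move=> a f g /asboolP[fL [M fM]] /asboolP[gL [N gN]].
have fgE x : (a *: f + g) x = a *: f x + g x by [].
apply/asboolP; split=> [b x y|].
  rewrite !fgE fL gL !scalerDr !scalerA [a * b]mulrC -!addrA; congr (_ + _).
  by rewrite addrCA.
exists (normc a * M + N) => x.
rewrite fgE (le_trans (rnormD _ _))// mulrDl lerD//.
by rewrite rnormZ -mulrA ler_wpM2l// normc_ge0.
Qed.
HB.instance Definition _ := GRing.SubChoice_isSubLmodule.Build _ _ _ A is_bop_submod.

Lemma bop_ext (u v : A) : (forall x, u x = v x) -> u = v.
Proof. by move=> uv; apply: val_inj; apply/funext. Qed.

Lemma bop_linear (u : A) a x y : u (a *: x + y) = a *: u x + u y.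
Proof. by have /asboolP[+ _] := bop_valP u; apply. Qed.

Lemma bopD (u : A) x y : u (x + y) = u x + u y.
Proof. by rewrite -{1}(scale1r x) bop_linear scale1r. Qed.

Lemma is_bop_id : id \in is_bop X.
Proof. by apply/asboolP; split=> //; exists 1 => x; rewrite mul1r. Qed.

Lemma is_bop_comp (u v : A) : u \o v \in is_bop X.
Proof.
apply/asboolP; split=> [a x y|]; first by rewrite /= !bop_linear.
have /asboolP[_ [M uM]] := bop_valP u; have /asboolP[_ [N vN]] := bop_valP v.
exists (`|M| * N) => x /=; rewrite (le_trans (uM _))//.
rewrite (@le_trans _ _ (`|M| * rnorm (v x)))//.
  by rewrite ler_wpM2r ?rnorm_ge0 ?ler_norm.
by rewrite -mulrA ler_wpM2l.
Qed.

Definition bop_one : A := Bop is_bop_id.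
Definition bop_mul (u v : A) : A := Bop (is_bop_comp u v).

Fact bop_mulA : associative bop_mul. Proof. by move=> u v w; exact: bop_ext. Qed.
Fact bop_mul1r : left_id bop_one bop_mul. Proof. by move=> u; exact: bop_ext. Qed.
Fact bop_mulr1 : right_id bop_one bop_mul. Proof. by move=> u; exact: bop_ext. Qed.
Fact bop_mulDl : left_distributive bop_mul +%R.
Proof. by move=> u v w; exact: bop_ext. Qed.
Fact bop_mulDr : right_distributive bop_mul +%R.
Proof. by move=> u v w; apply: bop_ext => x; exact: bopD. Qed.

(** The ring may be trivial: if [X] is the zero space then [1 = 0]. *)
HB.instance Definition _ := GRing.Zmodule_isPzRing.Build A
  bop_mulA bop_mul1r bop_mulr1 bop_mulDl bop_mulDr.

Lemma bopM (u v : A) x : (u * v) x = u (v x). Proof. by []. Qed.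
Lemma bop1 x : (1 : A) x = x. Proof. by []. Qed.
Lemma bop_scale a (u : A) x : (a *: u) x = a *: u x. Proof. by []. Qed.

Lemma bopX (u : A) n : u ^+ n = oppow u n :> (X -> X).
Proof.
elim: n => [//|n IHn]; apply/funext => x.
by rewrite exprS bopM IHn.
Qed.

Lemma bop_scaleAl a (u v : A) : a *: (u * v) = (a *: u) * v.
Proof. by apply: bop_ext. Qed.

Lemma bop0r (u : A) : u 0 = 0.
Proof. by have := bopD u 0 0; rewrite addr0 => /esym/(canRL (addrK _)); rewrite subrr. Qed.

Lemma bopZ (u : A) a x : u (a *: x) = a *: u x.
Proof. by rewrite -[a *: x]addr0 bop_linear bop0r addr0. Qed.

Lemma bop_scaleAr a (u v : A) : a *: (u * v) = u * (a *: v).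
Proof. by apply: bop_ext => x; rewrite bopM !bop_scale bopM bopZ. Qed.

Lemma bop_scaleX a (u : A) n : (a *: u) ^+ n = a ^+ n *: u ^+ n.
Proof.
elim: n => [|n IHn]; first by rewrite !expr0 scale1r.
by rewrite !exprS IHn -bop_scaleAl -bop_scaleAr scalerA.
Qed.

End bop_algebra.

(** * The operator norm *)

Section bnorm_theory.
Context {R : realType} {X : normedModType R[i]}.
Notation A := (bop X).
Implicit Types u v : A.

(* [opnorm (u + v)] would elaborate to a sum in the function space [X -> X]
   rather than in [bop X]. *)
Definition bnorm u : R := opnorm u.

Let bnorm_has_sup (u : A) :
  has_sup [set rnorm (u x) | x in [set x : X | rnorm x <= 1]].
Proof.
split; first by exists (rnorm (u 0)), 0 => //=; rewrite rnorm0 ler01.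
have /asboolP[_ [M uM]] := bop_valP u; exists `|M| => _ [x /= x1 <-].
rewrite (le_trans (uM x))// (@le_trans _ _ (`|M| * rnorm x))//.
  by rewrite ler_wpM2r ?rnorm_ge0 ?ler_norm.
by rewrite ler_piMr.
Qed.

(** Holds for any map, since [sup] of an unbounded set is [0]; this covers [U h] for [h] outside
    [(0, 1]]. *)
Lemma opnorm_ge0 (T : X -> X) : 0 <= opnorm T.
Proof.
rewrite /opnorm; set S := (X in sup X).
have [ubS|] := pselect (has_ubound S); last by move=> ?; rewrite sup_out// => -[].
apply: (le_trans (rnorm_ge0 (T 0))).
by apply: ub_le_sup => //; exists 0 => //=; rewrite rnorm0 ler01.
Qed.

Lemma bnorm_ge0 u : 0 <= bnorm u.
Proof. exact: opnorm_ge0. Qed.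

Lemma bnorm_le u (M : R) :
  0 <= M -> (forall x, rnorm (u x) <= M * rnorm x) -> bnorm u <= M.
Proof.
move=> M0 uM; apply: ge_sup; first exact: (bnorm_has_sup u).1.
by move=> _ [x /= x1 <-]; rewrite (le_trans (uM x))// ler_piMr.
Qed.

Lemma rnorm_bnorm u x : rnorm (u x) <= bnorm u * rnorm x.
Proof.
have [->|x0] := eqVneq x 0; first by rewrite bop0r !rnorm0 mulr0.
have nx0 : 0 < rnorm x by rewrite lt_neqAle eq_sym rnorm_eq0 x0 rnorm_ge0.
pose c := ((rnorm x)^-1)%:C%C : R[i].
have nc : normc c = (rnorm x)^-1 by rewrite normc_real// invr_ge0 ltW.
have : rnorm (u (c *: x)) <= bnorm u.
  apply: ub_le_sup; first exact: (bnorm_has_sup u).2.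
  by exists (c *: x) => //=; rewrite rnormZ nc mulVf// gt_eqF.
by rewrite bopZ rnormZ nc mulrC ler_pdivrMr.
Qed.

Lemma bnormD u v : bnorm (u + v) <= bnorm u + bnorm v.
Proof.
apply: bnorm_le => [|x]; first by rewrite addr_ge0 ?bnorm_ge0.
by rewrite (le_trans (rnormD _ _))// mulrDl lerD ?rnorm_bnorm.
Qed.

Lemma bnormM u v : bnorm (u * v) <= bnorm u * bnorm v.
Proof.
apply: bnorm_le => [|x]; first by rewrite mulr_ge0 ?bnorm_ge0.
rewrite (le_trans (rnorm_bnorm u (v x)))// -mulrA.
by rewrite ler_wpM2l ?bnorm_ge0 ?rnorm_bnorm.
Qed.

Let bnormZ_le z u : bnorm (z *: u) <= normc z * bnorm u.
Proof.
apply: bnorm_le => [|x]; first by rewrite mulr_ge0 ?bnorm_ge0 ?normc_ge0.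
by rewrite rnormZ -mulrA ler_wpM2l ?normc_ge0 ?rnorm_bnorm.
Qed.

Lemma bnorm0 : bnorm (0 : A) = 0.
Proof.
apply/eqP; rewrite eq_le bnorm_ge0 andbT; apply: bnorm_le => // x.
by rewrite mul0r rnorm0.
Qed.

Lemma bnormZ z u : bnorm (z *: u) = normc z * bnorm u.
Proof.
apply/eqP; rewrite eq_le bnormZ_le/=.
have [->|z0] := eqVneq z 0; first by rewrite normc0 mul0r bnorm_ge0.
have nz0 : 0 < normc z.
  by rewrite lt_neqAle normc_ge0 andbT eq_sym; apply: contra_neq z0 => /eq0_normc.
rewrite -ler_pdivlMl// -normcV; apply: le_trans (bnormZ_le _ _).
by rewrite scalerA mulVf// scale1r.
Qed.

Lemma bnormN u : bnorm (- u) = bnorm u.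
Proof. by rewrite -scaleN1r bnormZ normcN normc1 mul1r. Qed.

Lemma bnormB u v : bnorm (u - v) <= bnorm u + bnorm v.
Proof. by rewrite -(bnormN v) bnormD. Qed.

Lemma bnorm1_le : bnorm (1 : A) <= 1.
Proof. by apply: bnorm_le => // x; rewrite mul1r. Qed.

Lemma bnorm1 : (exists x : X, x != 0) -> bnorm (1 : A) = 1.
Proof.
move=> [x x0]; apply/eqP; rewrite eq_le bnorm1_le /=.
have nx0 : 0 < rnorm x by rewrite lt_neqAle eq_sym rnorm_eq0 x0 rnorm_ge0.
by have := rnorm_bnorm 1 x; rewrite bop1 ler_pMl.
Qed.

Lemma bnormX u n : bnorm (u ^+ n) <= bnorm u ^+ n.
Proof.
elim: n => [|n IHn]; first by rewrite !expr0 bnorm1_le.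
by rewrite !exprS (le_trans (bnormM _ _))// ler_wpM2l// bnorm_ge0.
Qed.

Lemma bnorm_sum n (f : nat -> A) (c : nat -> R) :
  (forall i, bnorm (f i) <= c i) ->
  bnorm (\sum_(i < n) f i) <= \sum_(i < n) c i.
Proof.
move=> fc; elim: n => [|n IHn]; first by rewrite !big_ord0 bnorm0.
by rewrite !big_ord_recr/= (le_trans (bnormD _ _))// lerD.
Qed.

End bnorm_theory.

(** * Neumann series *)

Section neumann.
Context {R : realType} {X : completeNormedModType R[i]}.
Notation A := (bop X).

(** Picard iteration from [0] of the contraction sending [x] to [y + e x]; completeness of [X]
    supplies the limit. *)
Lemma bnorm_half_fixed_point (e : A) (y : X) : bnorm e <= 2^-1 ->
  exists x, x - e x = y.
Proof.
move=> e2; pose s n := iter n (fun x => y + e x) 0.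
have sS n : s n.+1 = y + e (s n) by [].
have step n : rnorm (s n.+1 - s n) <= rnorm y * 2^-1 ^+ n.
  elim: n => [|n IHn].
    by rewrite sS /= bop0r addr0 subr0 expr0 mulr1.
  rewrite sS [in X in _ - X]sS opprD addrACA subrr add0r.
  have -> : e (s n.+1) - e (s n) = e (s n.+1 - s n).
    by rewrite bopD -[- s n]scaleN1r bopZ scaleN1r.
  rewrite (le_trans (rnorm_bnorm _ _))// exprS mulrCA.
  by rewrite ler_pM ?bnorm_ge0 ?rnorm_ge0.
(* The right-hand side is the closed form of the geometric sum of steps [n] to [n + k - 1]. *)
have dist n k : rnorm (s (n + k)%N - s n) <= rnorm y * (2 * 2^-1 ^+ n - 2 * 2^-1 ^+ (n + k)).
  elim: k => [|k IHk]; first by rewrite addn0 !subrr rnorm0 mulr0.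
  rewrite addnS -(subrKA (s (n + k)%N)) (le_trans (rnormD _ _))//.
  apply: (le_trans (lerD (step _) IHk)); rewrite exprS; lra.
have half_lt (r : R) : 0 < r -> exists n, rnorm y * (2 * 2^-1 ^+ n) < r.
  move=> r0; have := @cvg_geometric R (rnorm y * 2) 2^-1.
  rewrite ger0_norm// invf_lt1// ltr1n => /(_ isT)/cvgrPdist_lt/(_ _ r0)[n _ /(_ n (leqnn n))].
  rewrite /= sub0r normrN ger0_norm ?mulr_ge0 ?exprn_ge0 ?rnorm_ge0//.
  by rewrite -mulrA => ?; exists n.
have cs : cvg (s @ \oo).
  apply/cauchy_cvgP/cauchy_exP => eps eps0.
  have epsE : eps = (complex.Re eps)%:C%C by rewrite RRe_real// gtr0_real.
  move: eps0; rewrite epsE ltcR => r0.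
  have [n nr] := half_lt _ r0.
  exists (s n), n => // m /= nm; rewrite -ball_normE /= distrC rnormE ltcR.
  rewrite -(subnKC nm) (le_lt_trans (dist _ _))// (le_lt_trans _ nr)//.
  by rewrite ler_wpM2l ?rnorm_ge0// gerBl mulr_ge0// exprn_ge0.
have /cvg_ex[l sl] := cs; exists l; apply/eqP; rewrite -subr_eq0 -rnorm_eq0.
rewrite eq_le rnorm_ge0 andbT; apply/ler_addgt0Pr => r r0; rewrite add0r.
have r20 : (0 : R[i]) < (r / 2)%:C%C by rewrite ltcR divr_gt0.
have /cvgrPdist_lt/(_ _ r20)[N _ sN] := sl.
have sNr n : (N <= n)%N -> rnorm (l - s n) < r / 2.
  by move=> /sN; rewrite /= rnormE ltcR.
(* The recurrence for [s N.+1] splits the defect of [l] into two terms that tend to [0]. *)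
have -> : l - e l - y = (l - s N.+1) + e (s N - l).
  rewrite sS bopD -[- l]scaleN1r bopZ scaleN1r opprD.
  by rewrite [l + (_ - _)]addrA subrKA addrAC.
rewrite (le_trans (rnormD _ _))// (le_trans (lerD (ltW (sNr _ _)) (rnorm_bnorm _ _)))//.
rewrite -[s N - l]opprB rnormN.
have h1 := sNr N (leqnn _).
have h2 : bnorm e * rnorm (l - s N) <= 1 * rnorm (l - s N).
  by rewrite ler_wpM2r ?rnorm_ge0// (le_trans e2)// invf_le1// ler1n.
lra.
Qed.

(** The estimate [|x| <= 2 |x - e x|] makes [1 - e] injective, so the chosen preimages are linear in
    [y]; it also bounds the inverse by [2]. *)
Lemma neumann_inverse (e : A) : bnorm e <= 2^-1 ->
  exists2 f : A, (1 - e) * f = 1 /\ f * (1 - e) = 1 & bnorm f <= 2.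
Proof.
move=> e2; have /choice[f fE] := fun y => bnorm_half_fixed_point y e2.
have ebound x : rnorm x <= 2 * rnorm (x - e x).
  have h1 : rnorm x <= rnorm (x - e x) + rnorm (e x) by rewrite -{1}(subrK (e x) x) rnormD.
  have h2 : rnorm (e x) <= 2^-1 * rnorm x.
    by rewrite (le_trans (rnorm_bnorm _ _))// ler_wpM2r ?rnorm_ge0.
  lra.
have inj x x' : x - e x = x' - e x' -> x = x'.
  move=> xx'; apply/eqP; rewrite -subr_eq0 -rnorm_eq0 eq_le rnorm_ge0 andbT.
  rewrite (le_trans (ebound _))//.
  rewrite bopD -[- x']scaleN1r bopZ !scaleN1r opprD addrACA xx' -opprD subrr rnorm0 mulr0//.
have fB : f \in is_bop X.
  apply/asboolP; split=> [a x y|].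
    apply: inj; rewrite fE bop_linear opprD addrACA -scalerBr !fE//.
  by exists 2 => x; rewrite -{2}(fE x).
exists (Bop fB).
  split; apply: bop_ext => x; first exact: fE.
  by rewrite bopM bop1; apply: inj; rewrite fE.
by apply: bnorm_le => // x; rewrite -{2}(fE x).
Qed.

End neumann.

(** * Power bounds from resolvent bounds on a disc *)

Section uniform_power_bound.
Context {R : realType} {X : normedModType R[i]}.
Notation A := (bop X).
Implicit Types (u : A) (z w : R[i]) (s B C M : R).

Lemma pow2_root_of_minus_one n : exists2 z : R[i], normc z = 1 & z ^+ (2 ^ n) = -1.
Proof.
elim: n => [|n [z z1 zn]]; first by exists (-1); rewrite ?normcN ?normc1.
have sz : sqrtc z ^+ 2 = z by exact: sqr_sqrtc.
exists (sqrtc z); last by rewrite expnS exprM sz.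
apply/eqP; rewrite -(@pexpr_eq1 _ _ 2) ?normc_ge0//.
by rewrite expr2 -normcM -expr2 sz z1.
Qed.

Definition bounded_inverse M (a : A) :=
  exists g : A, [/\ g * a = 1, a * g = 1 & bnorm g <= M].

(** Here [z] is the reciprocal of the spectral parameter, so that the region outside a disc around
    [0] becomes a compact disc. *)
Definition disc_resolvent_bound u B M :=
  forall z, normc z <= B -> bounded_inverse M (1 - z *: u).

(* [F n.+1 z] is the mean of [F n z] and [F n (zeta z)] where
   [zeta ^ (2 ^ n) = -1]; averaging over a rotation preserves the Lipschitz
   constant. *)
Lemma lipschitz_power_resolvent u B M : disc_resolvent_bound u B M ->
  forall n, exists F : R[i] -> A,
    (forall z, normc z <= B -> F z * (1 - z ^+ (2 ^ n) *: u ^+ (2 ^ n)) = 1) /\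
    (forall z w, normc z <= B -> normc w <= B ->
      bnorm (F z - F w) <= M * bnorm u * M * normc (z - w)).
Proof.
move=> res; elim=> [|n [F [FE FL]]].
  have /choice[F FE] : forall z, exists g : A, normc z <= B ->
      [/\ g * (1 - z *: u) = 1, (1 - z *: u) * g = 1 & bnorm g <= M].
    move=> z; have [zB|zB] := boolP (normc z <= B); last by exists 0.
    by have [g gE] := res z zB; exists g.
  exists F; split=> [z /FE[+ _ _]|z w zB wB]; first by rewrite !expr1.
  have [zl _ zM] := FE z zB; have [_ wr wM] := FE w wB.
  (* Resolvent identity. *)
  have -> : F z - F w = (z - w) *: (F z * u * F w).
    have {1}-> : F z = F z * (1 - w *: u) * F w by rewrite -mulrA wr mulr1.
    have {2}-> : F w = F z * (1 - z *: u) * F w by rewrite zl mul1r.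
    rewrite -mulrBl -mulrBr opprB addrC addrA subrK -scalerBl.
    by rewrite -bop_scaleAr -bop_scaleAl.
  rewrite bnormZ mulrC ler_wpM2r ?normc_ge0// (le_trans (bnormM _ _))//.
  rewrite ler_pM ?bnorm_ge0// (le_trans (bnormM _ _))//.
  by rewrite ler_wpM2r ?bnorm_ge0.
have [zeta zeta1 zetan] := pow2_root_of_minus_one n.
have zetaB z : normc z <= B -> normc (zeta * z) <= B by rewrite normcM zeta1 mul1r.
(* The rotation turns [1 - v] into [1 + v], and the mean of their left inverses is a left inverse of
   [1 - v * v]. *)
exists (fun z => 2^-1 *: (F z + F (zeta * z))); split=> [z zB|z w zB wB].
  set v := z ^+ (2 ^ n) *: u ^+ (2 ^ n).
  have -> : z ^+ (2 ^ n.+1) *: u ^+ (2 ^ n.+1) = v * v.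
    by rewrite expnS mulnC !exprM -[in RHS]expr2 bop_scaleX.
  have Fz : F z * (1 - v) = 1 by rewrite FE.
  have Fzz : F (zeta * z) * (1 + v) = 1.
    have := FE _ (zetaB _ zB).
    by rewrite exprMn zetan mulN1r scaleNr opprK.
  have vv1 : 1 - v * v = (1 - v) * (1 + v).
    by rewrite mulrDr mulr1 mulrBl mul1r subrKA.
  have vv2 : 1 - v * v = (1 + v) * (1 - v).
    by rewrite mulrDl mul1r mulrBr mulr1 subrKA.
  rewrite -bop_scaleAl mulrDl {1}vv1 vv2 !mulrA Fz Fzz !mul1r.
  rewrite addrACA subrr addr0 -mulr2n -(@scaler_nat R[i] A) scalerA mulVf ?scale1r//.
rewrite -scalerBr bnormZ opprD addrACA.
have -> : normc (2^-1 : R[i]) = 2^-1.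
  rewrite normcV; have -> : (2 : R[i]) = ((2 : R)%:C%C) by rewrite rmorph_nat.
  by rewrite normc_real.
have h1 := FL _ _ zB wB; have h2 := FL _ _ (zetaB _ zB) (zetaB _ wB).
rewrite -mulrBr normcM zeta1 mul1r in h2.
have h3 := bnormD (F z - F w) (F (zeta * z) - F (zeta * w)).
lra.
Qed.

(* Squaring turns [1/8] into [1/64]; the resolvent at [s] is then within [1/63]
   of [1], hence the one at [s + d] within [1/63 + 1/16 < 1/9], which gives back
   [(1/9) / (1 - 1/9) = 1/8]. *)
Lemma power_bound_step u B M s d n : disc_resolvent_bound u B M ->
  0 <= s -> 0 <= d -> s + d <= B -> M * bnorm u * M * d <= 16^-1 ->
  s ^+ (2 ^ n) * bnorm (u ^+ (2 ^ n)) <= 8^-1 ->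
  (s + d) ^+ (2 ^ n.+1) * bnorm (u ^+ (2 ^ n.+1)) <= 8^-1.
Proof.
move=> res s0 d0 sdB Ld q.
have [F [FE FL]] := lipschitz_power_resolvent res n.+1.
pose V (r : R) := (r%:C%C : R[i]) ^+ (2 ^ n.+1) *: u ^+ (2 ^ n.+1).
have VE r : 0 <= r -> bnorm (V r) = r ^+ (2 ^ n.+1) * bnorm (u ^+ (2 ^ n.+1)).
  by move=> r0; rewrite bnormZ -(rmorphXn (real_complex R)) normc_real// exprn_ge0.
have Vs : bnorm (V s) <= 64^-1.
  rewrite VE// expnS mulnC !exprM.
  have := bnormM (u ^+ (2 ^ n)) (u ^+ (2 ^ n)).
  rewrite -expr2 => /(ler_wpM2l (sqr_ge0 (s ^+ (2 ^ n))))/le_trans; apply.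
  rewrite -expr2 -exprMn (_ : 64^-1 = 8^-1 ^+ 2); last by rewrite exprVn -natrX.
  by rewrite lerXn2r// nnegrE ?mulr_ge0 ?exprn_ge0 ?bnorm_ge0.
rewrite -VE ?addr_ge0//; set v := V s in Vs; set v' := V (s + d).
set a := F (s%:C%C); set b := F ((s + d)%:C%C).
have av : a * (1 - v) = 1 by rewrite FE// normc_real//; lra.
have bv : b * (1 - v') = 1 by rewrite FE// normc_real// addr_ge0.
have ba : bnorm (b - a) <= 16^-1.
  apply: (le_trans _ Ld).
  have := FL ((s + d)%:C%C) (s%:C%C).
  rewrite -(rmorphB (real_complex R)) [s + d - s]addrAC subrr add0r.
  by rewrite !normc_real ?addr_ge0//; apply=> //; lra.
(* Since [a - 1 = a * v] and [|a| <= 1 + |a - 1|], the estimate closes on itself; the bound on [v']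
   below works in the same way. *)
have a1 : bnorm (a - 1) <= (1 + bnorm (a - 1)) * 64^-1.
  have {1}-> : a - 1 = a * v by rewrite -av mulrBr mulr1 opprB addrC subrK.
  rewrite (le_trans (bnormM _ _))// ler_pM ?bnorm_ge0//.
  by rewrite -{1}(subrK 1 a) addrC (le_trans (bnormD _ _))// lerD2r bnorm1_le.
have b1 : bnorm (1 - b) <= 9^-1.
  have := bnormD (b - a) (a - 1); rewrite subrKA => h.
  rewrite -bnormN opprB.
  by move: (bnorm (b - 1)) (bnorm (b - a)) (bnorm (a - 1)) h ba a1
    => p q' r h1 h2 h3; clear -h1 h2 h3; lra.
have : bnorm v' <= 9^-1 * (1 + bnorm v').
  have {1}-> : v' = - ((1 - b) * (1 - v')).
    by rewrite mulrBl bv mul1r opprB opprB addrC subrK.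
  rewrite bnormN (le_trans (bnormM _ _))// ler_pM ?bnorm_ge0//.
  by rewrite (le_trans (bnormB _ _))// lerD2r bnorm1_le.
by move: (bnorm v') => t; clear; lra.
Qed.

(** Induction starts at [s = 0] with exponent [2 ^ 0 = 1], where the product vanishes; each step
    adds [d] and doubles the exponent. *)
Lemma power_bound_steps u B M d k : disc_resolvent_bound u B M ->
  0 <= d -> k%:R * d <= B -> M * bnorm u * M * d <= 16^-1 ->
  (k%:R * d) ^+ (2 ^ k) * bnorm (u ^+ (2 ^ k)) <= 8^-1.
Proof.
move=> res d0 + Ld; elim: k => [|k IHk] kB.
  by rewrite mul0r expr1 mul0r invr_ge0.
have kE : k.+1%:R * d = k%:R * d + d by rewrite -natr1 mulrDl mul1r.
rewrite kE; apply: (power_bound_step res) => //.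
- by rewrite mulr_ge0.
- by rewrite -kE.
- by apply: IHk; apply: le_trans kB; rewrite kE lerDl.
Qed.

(** The exponent depends on [B], [C] and [M] alone, so one power serves every small [h]. *)
Lemma uniform_power_bound B C M : 0 <= B -> exists k, forall u,
  bnorm u <= C -> disc_resolvent_bound u B M ->
  B ^+ (2 ^ k) * bnorm (u ^+ (2 ^ k)) <= 8^-1.
Proof.
(* Taking [k > L] makes the step [B / k] meet the requirement
   [M * bnorm u * M * (B / k) <= 1 / 16]. *)
move=> B0; pose L := `|16 * (M * C * M) * B|.
exists (Num.truncn L).+1 => u uC res.
have kL : L < (Num.truncn L).+1%:R by exact: truncnS_gt.
set k := (Num.truncn L).+1 in kL *.
have k0 : 0 < k%:R :> R by rewrite ltr0n.
have kB : k%:R * (B / k%:R) = B by rewrite mulrC divfK// gt_eqF.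
have := @power_bound_steps u B M (B / k%:R) k res; rewrite kB; apply=> //.
  by rewrite divr_ge0// ltW.
rewrite mulrA ler_pdivrMr//.
have h : M * bnorm u * M * B <= M * C * M * B.
  rewrite ler_wpM2r// !(mulrC _ M) !mulrA ler_wpM2l//.
  by rewrite -expr2 sqr_ge0.
have := ler_norm (16 * (M * C * M) * B); rewrite -/L; lra.
Qed.

End uniform_power_bound.

(** * Right neighbourhoods of [0] and limits superior *)

Section near_right.
Context {R : realType}.

Lemma near_right01 : \forall h \near (0 : R)^'+, 0 < h <= 1.
Proof.
by near=> h; apply/andP; split; [near: h; exact: nbhs_right_gt
  | near: h; exact: nbhs_right_le].
Unshelve. all: by end_near. Qed.

Lemma limf_esup_le (f : R -> R) (F : set_system R) (c : R) :
  (\forall h \near F, f h <= c) -> (limf_esup (EFin \o f) F <= c%:E)%E.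
Proof.
move=> fc; rewrite limf_esupE.
apply: (@le_trans _ _ (ereal_sup ((EFin \o f) @` [set h | f h <= c]))).
  by apply: ereal_inf_lbound; exists [set h | f h <= c].
by apply: ge_ereal_sup => _ [h /= fhc <-]; rewrite lee_fin.
Qed.

(** An infimum strictly below [c] yields a member of [F] on which the supremum is below [c]. *)
Lemma limf_esup_lt (f : R -> R) (F : set_system R) {FF : Filter F} (c : R) :
  (limf_esup (EFin \o f) F < c%:E)%E -> \forall h \near F, f h <= c.
Proof.
rewrite limf_esupE => /ereal_inf_lt[_ [V FV <-] Vc].
apply: filterS FV => h Vh; rewrite -lee_fin.
by apply: le_trans (ltW Vc); apply: ereal_sup_ubound; exists h.
Qed.

End near_right.

(** * Families of operators: resolvent set, quasinilpotence and spectrum *)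

Section families.
Context {R : realType} {X : completeNormedModType R[i]}.
Notation A := (bop X).

(** By Neumann series [a * g] has a right inverse [f] and [g * a] a left inverse [f']; then [g * f]
    and [f' * g] are right and left inverses of [a], hence equal. *)
Lemma approx_inverse (a g : A) :
  bnorm (a * g - 1) <= 2^-1 -> bnorm (g * a - 1) <= 2^-1 ->
  bounded_inverse (2 * bnorm g) a.
Proof.
rewrite -bnormN opprB => /neumann_inverse[f [+ _] f2].
rewrite -bnormN opprB => + /neumann_inverse[f' [_ +] _].
rewrite !opprB !(addrC 1) !subrK => agf fga.
exists (g * f); split; last first.
- by rewrite (le_trans (bnormM _ _))// mulrC ler_wpM2r ?bnorm_ge0.
- by rewrite mulrA.
have <- : f' * g = g * f by rewrite -[f' * g]mulr1 -agf !mulrA -(mulrA f') fga mul1r.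
by rewrite -mulrA.
Qed.

Lemma Cb_lift (U : R -> X -> X) : Cb U -> exists (V : R -> A) (C : R),
  0 <= C /\ forall h, 0 < h <= 1 -> U h = V h :> (X -> X) /\ bnorm (V h) <= C.
Proof.
move=> [Ub [C UC]].
have /choice[V VU] : forall h, exists v : A, 0 < h <= 1 -> U h = v :> (X -> X).
  move=> h; have [h01|] := boolP (0 < h <= 1); last by exists 0.
  have Uh : U h \in is_bop X by apply/asboolP; exact: Ub.
  by exists (Bop Uh).
exists V, `|C|; split=> // h h01; split; first exact: VU.
by rewrite /bnorm -VU// (le_trans (UC _ h01))// ler_norm.
Qed.

Context (U : R -> X -> X) (V : R -> A) (C : R) (C0 : 0 <= C)
  (UV : forall h, 0 < h <= 1 -> U h = V h :> (X -> X) /\ bnorm (V h) <= C).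

(** Errors at most [1 / 2] already turn an asymptotic inverse into an exact one. Conversely, exact
    inverses make both error norms eventually constant, equal to [0]. *)
Lemma resolvent_setP lam : resolvent_set U lam <->
  exists M : R, \forall h \near 0^'+, bounded_inverse M (lam *: (1 : A) - V h).
Proof.
split=> [[S [/Cb_lift[T [M [M0 ST]]] [rinv linv]]]|[M inv]].
  exists (2 * M); have h2 : 0 < 2^-1 :> R by rewrite invr_gt0.
  move/cvgrPdist_le/(_ _ h2) : rinv => rinv; move/cvgrPdist_le/(_ _ h2) : linv => linv.
  near=> h; have h01 : 0 < h <= 1 by near: h; exact: near_right01.
  have [UE UC] := UV h01; have [SE SM] := ST _ h01.
  have [] := @approx_inverse (lam *: (1 : A) - V h) (T h).
  - have : `|0 - opnorm (fun x => lam *: S h x - U h (S h x) - x)| <= 2^-1 by near: h.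
    by rewrite sub0r normrN ger0_norm ?opnorm_ge0// UE SE.
  - have : `|0 - opnorm (fun x => S h (lam *: x - U h x) - x)| <= 2^-1 by near: h.
    by rewrite sub0r normrN ger0_norm ?opnorm_ge0// UE SE.
  - move=> g [gl gr gM]; exists g; split=> //.
    by rewrite (le_trans gM)// ler_pM2l.
(* Where there is no bounded inverse the witness is [0]: [Cb] asks for a bound at every [h] in
   [(0, 1]], not just at small [h]. *)
have /choice[S SE] : forall h, exists g : A,
    (bounded_inverse M (lam *: (1 : A) - V h) ->
      g * (lam *: (1 : A) - V h) = 1 /\ (lam *: (1 : A) - V h) * g = 1) /\ bnorm g <= `|M|.
  move=> h; have [[g [gl gr gM]]|] := pselect (bounded_inverse M (lam *: (1 : A) - V h)).
    by exists g; split=> //; rewrite (le_trans gM)// ler_norm.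
  by move=> gE; exists 0; rewrite bnorm0; split.
exists S; split.
  split=> [h _|]; first by apply/asboolP; exact: bop_valP.
  by exists `|M| => h _; have [] := SE h.
have S01 : \forall h \near (0 : R)^'+, U h = V h :> (X -> X) /\
    S h * (lam *: (1 : A) - V h) = 1 /\ (lam *: (1 : A) - V h) * S h = 1.
  near=> h; split; first by apply: (UV _).1; near: h; exact: near_right01.
  by apply: (SE h).1; near: h.
split; apply: cvg_near_cst; apply: filterS S01 => h [-> [Sl Sr]].
- by rewrite -[RHS](@bnorm0 _ X) -(subrr 1) -{1}Sr.
- by rewrite -[RHS](@bnorm0 _ X) -(subrr 1) -{1}Sl.
Unshelve. all: by end_near. Qed.

Lemma near_UV : \forall h \near (0 : R)^'+, U h = V h :> (X -> X) /\ bnorm (V h) <= C.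
Proof. by apply: filterS near_right01 => h /UV. Qed.

Lemma near_opnormX n :
  \forall h \near (0 : R)^'+, opnorm (oppow (U h) n) = bnorm (V h ^+ n).
Proof. by apply: filterS near_UV => h [-> _]; rewrite /bnorm bopX. Qed.

Let l n := limf_esup (fun h : R => (opnorm (oppow (U h) n))%:E) (0 : R)^'+.

Let l_le n (c : R) :
  (\forall h \near (0 : R)^'+, bnorm (V h ^+ n) <= c) -> (l n <= c%:E)%E.
Proof.
move=> Vc; apply: limf_esup_le; move: Vc; apply: filterS2 (near_opnormX n).
by move=> h ->.
Qed.

Let l_lt n (c : R) :
  (l n < c%:E)%E -> \forall h \near (0 : R)^'+, bnorm (V h ^+ n) <= c.
Proof.
by move=> /limf_esup_lt; apply: filterS2 (near_opnormX n) => h <-.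
Qed.

Let l_ge0 n : (0 <= l n)%E.
Proof.
apply: limf_esup_ge0; first exact: filter_not_empty.
by move=> h; rewrite lee_fin opnorm_ge0.
Qed.

(** The limit superior lies between [0] and [C ^+ n], so [fine] never takes its default value. *)
Let lK n : (fine (l n))%:E = l n.
Proof.
rewrite fineK// fin_numElt (lt_le_trans _ (l_ge0 n))//=.
apply: (@le_lt_trans _ _ (C ^+ n)%:E); last exact: ltry.
apply: l_le; apply: filterS near_UV => h [_ VC].
by rewrite (le_trans (bnormX _ _))// lerXn2r ?nnegrE ?bnorm_ge0.
Qed.

(** One small power controls all later ones: dividing [n] by [N], submultiplicativity costs a factor
    independent of [n], which the [n]-th root removes. *)
Lemma asymp_quasinilpotentP : asymp_quasinilpotent U <->
  forall e : R, 0 < e ->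
    exists2 n, (0 < n)%N & \forall h \near 0^'+, bnorm (V h ^+ n) <= e ^+ n.
Proof.
split=> [qn e e0|qn].
  (* The successor avoids the exponent [0^-1 = 0], for which the root cannot be undone. *)
  move/cvgrPdist_lt/(_ _ e0) : qn => [n _ /(_ n.+1 (leqnSn n))] /=.
  rewrite -/(l n.+1) sub0r normrN ger0_norm ?powR_ge0// => ane.
  exists n.+1 => //; apply: l_lt; rewrite -lK lte_fin.
  have -> : fine (l n.+1) = (fine (l n.+1) `^ n.+1%:R^-1) ^+ n.+1.
    by rewrite -powR_mulrn ?powR_ge0// -powRrM mulVf ?powRr1 ?fine_ge0// pnatr_eq0.
  by rewrite ltrXn2r// powR_ge0.
(* Once [D <= 2 ^+ n], the root is at most [2 * d = e / 2]. *)
apply/cvgrPdist_lt => e e0; pose d := e / 4.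
have d0 : 0 < d by rewrite divr_gt0.
(* [D] dominates [(C / d) ^+ r] for every remainder [r < N]. *)
have [N N0 VN] := qn d d0; pose D := (1 + C / d) ^+ N.
have Cd0 : 0 <= C / d by rewrite divr_ge0// ltW.
have Vn n : \forall h \near (0 : R)^'+, bnorm (V h ^+ n) <= d ^+ n * D.
  near=> h; have [_ VC] : U h = V h :> (X -> X) /\ bnorm (V h) <= C.
    by near: h; exact: near_UV.
  have VNh : bnorm (V h ^+ N) <= d ^+ N by near: h.
  rewrite {1 2}(divn_eq n N) mulnC !exprD !exprM (le_trans (bnormM _ _))//.
  rewrite -mulrA ler_pM ?bnorm_ge0//.
    by rewrite (le_trans (bnormX _ _))// lerXn2r ?nnegrE ?bnorm_ge0 ?exprn_ge0// ltW.
  apply: (@le_trans _ _ (C ^+ (n %% N))).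
    by rewrite (le_trans (bnormX _ _))// lerXn2r ?nnegrE ?bnorm_ge0.
  have -> : C = d * (C / d) by rewrite mulrC divfK// gt_eqF.
  rewrite exprMn ler_wpM2l ?exprn_ge0// ?(ltW d0)//.
  apply: (@le_trans _ _ ((1 + C / d) ^+ (n %% N))).
    by rewrite lerXn2r ?nnegrE ?addr_ge0// lerDr.
  by rewrite ler_weXn2l// ?lerDl// ltnW// ltn_mod.
exists (Num.truncn D).+1 => // n /= Dn.
have Dn2 : D <= 2 ^+ n.
  rewrite (le_trans (ltW (truncnS_gt _)))// -natrX ler_nat.
  by rewrite (leq_trans Dn)// ltnW// ltn_expl.
have n0 : (0 < n)%N by exact: leq_trans Dn.
have := l_le (Vn n); rewrite -lK lee_fin => lD.
rewrite -/(l n) sub0r normrN ger0_norm ?powR_ge0//.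
apply: (@le_lt_trans _ _ (((2 * d) ^+ n) `^ n%:R^-1)).
  rewrite ge0_ler_powR ?invr_ge0 ?nnegrE ?exprn_ge0 ?mulr_ge0 ?(ltW d0) ?(ltW e0) ?fine_ge0//.
  by apply: (le_trans lD); rewrite [leRHS]exprMn [leRHS]mulrC ler_wpM2l// exprn_ge0// ltW.
have d2 : 0 <= 2 * d by rewrite mulr_ge0// ltW.
rewrite -(powR_mulrn n d2) -powRrM mulfV ?pnatr_eq0 -?lt0n//.
rewrite powRr1// /d; lra.
Unshelve. all: by end_near. Qed.

(** The inverse at [z0] is an approximate inverse at nearby [z]. The quantifier on [z] stands inside
    [near], so one range of [h] serves the whole neighbourhood of [z0]. *)
Lemma near_inverse_perturbation z0 M :
  (\forall h \near (0 : R)^'+, bounded_inverse M (1 - z0 *: V h)) ->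
  \forall h \near (0 : R)^'+, forall z, normc (z - z0) * (`|M| * C) <= 2^-1 ->
    bounded_inverse (2 * `|M|) (1 - z *: V h).
Proof.
apply: filterS2 near_UV => h [_ VC] [g [gl gr gM]] z zz0.
have {}gM : bnorm g <= `|M| by rewrite (le_trans gM)// ler_norm.
have E : 1 - z *: V h = (1 - z0 *: V h) - (z - z0) *: V h.
  by rewrite scalerBl opprB addrA subrK.
have small (v : A) : bnorm v <= `|M| * C -> bnorm (- ((z - z0) *: v)) <= 2^-1.
  move=> vM; rewrite bnormN bnormZ (le_trans _ zz0)//.
  by rewrite ler_wpM2l ?normc_ge0.
have [||b [bl br bM]] := @approx_inverse (1 - z *: V h) g.
- rewrite E mulrBl gr [X in bnorm X](_ : _ = - ((z - z0) *: (V h * g))).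
    apply: small; rewrite (le_trans (bnormM _ _))// mulrC.
    by rewrite ler_pM ?bnorm_ge0.
  by rewrite -bop_scaleAl addrC addrA addNr add0r.
- rewrite E mulrBr gl [X in bnorm X](_ : _ = - ((z - z0) *: (g * V h))).
    apply: small; rewrite (le_trans (bnormM _ _))//.
    by rewrite ler_pM ?bnorm_ge0.
  by rewrite -bop_scaleAr addrC addrA addNr add0r.
by exists b; split=> //; rewrite (le_trans bM)// ler_pM2l.
Qed.

(** The disc lies in the square [K], whose compactness makes the local bounds uniform. *)
Lemma disc_near_resolvent_bound B :
  (forall z, exists M, \forall h \near (0 : R)^'+, bounded_inverse M (1 - z *: V h)) ->
  exists M, \forall h \near (0 : R)^'+, disc_resolvent_bound (V h) B M.
Proof.
move=> res; pose K := (`[- B, B] `*` `[- B, B])%classic : set (R * R).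
have cK : compact K by apply: compact_setX; exact: segment_compact.
pose P (i : R * R) (x : R * R) := bounded_inverse i.2 (1 - (x.1 +i* x.2)%C *: V i.1).
(* The product filter sends [h] to [0] and the bound to [+oo] together, so that both become uniform
   over [K]. *)
have [[Q1 Q2] [Q1near [b [_ Q2b]]] QK] :
    \forall i \near filter_prod (0 : R)^'+ (+oo : set_system R), K `<=` P i.
  apply: (iffLR (compact_near_coveringP K) cK) => x Kx.
  have [M /near_inverse_perturbation Mx] := res (x.1 +i* x.2)%C.
  (* Coordinates within [d] give distance at most [2 * d], and [2 * d * (|M| * C) <= 1 / 2]; the
     [+ 1] keeps the denominator positive. *)
  pose d := (4 * (`|M| * C + 1))^-1.
  have MC0 : 0 <= `|M| * C by rewrite mulr_ge0.
  have d0 : 0 < d by rewrite invr_gt0 mulr_gt0// ltr_wpDl.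
  near=> y i; rewrite /P.
  have [x1 x2] : ball x d y by near: y; exact: nbhsx_ballx.
  have [g [gl gr gM]] : bounded_inverse (2 * `|M|) (1 - (y.1 +i* y.2)%C *: V i.1).
    have inv : forall z, normc (z - (x.1 +i* x.2)%C) * (`|M| * C) <= 2^-1 ->
        bounded_inverse (2 * `|M|) (1 - z *: V i.1).
      by near: i; exact: (cvg_fst Mx).
    apply: inv; apply: (@le_trans _ _ (2 * d * (`|M| * C))).
      rewrite ler_wpM2r// (le_trans (normc_le_ReIm _))//=.
      move: x1 x2; rewrite -!ball_normE /= !(distrC x.1) !(distrC x.2); lra.
    have : d * (4 * (`|M| * C + 1)) = 1.
      by rewrite mulVf// mulf_neq0// gt_eqF// ltr_wpDl.
    lra.
  have iM : 2 * `|M| <= i.2.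
    near: i; apply: (cvg_snd (nbhs_pinfty_ge _)); exact: num_real.
  by exists g; split=> //; exact: (le_trans gM).
exists (b + 1); move: Q1near; apply: filterS => h Q1h [x y] zB.
have /= [zR zI] := ReIm_le_normc (x +i* y)%C.
apply: (QK (h, b + 1) _ (x, y)); first by split=> //=; apply: Q2b; rewrite ltrDl.
split; rewrite /= in_itv/= -ler_norml.
  exact: le_trans zR zB.
exact: le_trans zI zB.
Unshelve. all: by end_near. Qed.

Lemma spectrum_eq0_asymp_quasinilpotent :
  spectrum U = [set 0] -> asymp_quasinilpotent U.
Proof.
move=> sp; have res z : exists M,
    \forall h \near (0 : R)^'+, bounded_inverse M (1 - z *: V h).
  have [->|z0] := eqVneq z 0.
    exists 1; apply: nearW => h; exists 1.
    by rewrite scale0r subr0 mulr1 bnorm1_le.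
  have : resolvent_set U z^-1.
    apply: contrapT => zU; have : spectrum U z^-1 by [].
    by rewrite sp /= => /eqP; rewrite invr_eq0 (negbTE z0).
  move=> /resolvent_setP[M inv]; exists (normc z^-1 * M).
  apply: filterS inv => h [g [gl gr gM]]; exists (z^-1 *: g).
  have -> : 1 - z *: V h = z *: (z^-1 *: (1 : A) - V h).
    by rewrite scalerBr scalerA mulfV// scale1r.
  rewrite -!bop_scaleAl -!bop_scaleAr !scalerA gl gr mulfV// mulVf//.
  by rewrite scale1r bnormZ ler_wpM2l ?normc_ge0.
(* With [B = 1 / e] and [N = 2 ^ k], the uniform power bound reads [|V_h ^ N| <= e ^ N / 8]. *)
apply/asymp_quasinilpotentP => e e0; pose B := e^-1.
have B0 : 0 < B by rewrite invr_gt0.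
have [M resM] := disc_near_resolvent_bound B res.
have [k kB] := @uniform_power_bound R X B C M (ltW B0).
exists (2 ^ k)%N; first by rewrite expn_gt0.
move: resM; apply: filterS2 near_UV => h [_ VC] /(kB _ VC).
rewrite /B exprVn ler_pdivrMl ?exprn_gt0// => /le_trans; apply.
by rewrite ler_piMr ?exprn_ge0 ?(ltW e0)// invf_le1// ler1n.
Qed.

(** A nonzero vector gives the identity norm [1]; on the zero space every operator is invertible and
    the spectrum is empty. *)
Lemma asymp_quasinilpotent_spectrum (hX : exists x : X, x != 0) :
  asymp_quasinilpotent U -> spectrum U = [set 0].
Proof.
move=> /asymp_quasinilpotentP qn; apply/seteqP; split=> [lam|_ ->].
  apply: contra_notP => /eqP lam0; apply/resolvent_setP.
  pose r := normc lam.
  have r0 : 0 < r.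
    by rewrite lt_neqAle normc_ge0 andbT eq_sym; apply: contra_neq lam0 => /eq0_normc.
  have [n n0 Vn] := qn (r / 2) (divr_gt0 r0 (ltr0Sn _ _)).
  (* The truncated geometric series is an approximate inverse of [1 - w]: its error [w ^+ n] has
     norm at most [2 ^ - n], by the choice of [r / 2]. *)
  pose S h := \sum_(i < n) (lam^-1 *: V h) ^+ i.
  exists (r^-1 * (2 * \sum_(i < n) (r^-1 * C) ^+ i)).
  move: Vn; apply: filterS2 near_UV => h [_ VC] Vn.
  set w := lam^-1 *: V h.
  have wn : bnorm (w ^+ n) <= 2^-1.
    rewrite bop_scaleX bnormZ.
    have -> : normc (lam^-1 ^+ n) = r^-1 ^+ n.
      by elim: (n) => [|m IHm]; rewrite ?normc1// !exprS normcM normcV IHm.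
    rewrite (le_trans (ler_wpM2l _ Vn)) ?exprn_ge0 ?invr_ge0 ?(ltW r0)//.
    rewrite -exprMn mulrA mulVf ?gt_eqF// mul1r.
    by rewrite -[leRHS]expr1 ler_wiXn2l ?invr_ge0 ?invf_le1 ?ler1n.
  have wS : (1 - w) * S h = 1 - w ^+ n.
    by rewrite -[1 - w ^+ n]opprB subrX1 -mulNr opprB.
  have Sw : S h * (1 - w) = 1 - w ^+ n.
    rewrite -wS; apply/esym/commr_sum => i _; apply: commrX.
    by apply/commr_sym/commrB; [exact: commr1|exact: commr_refl].
  have [||b [bl br bS]] := @approx_inverse (1 - w) (S h).
  - by rewrite wS addrAC subrr add0r bnormN.
  - by rewrite Sw addrAC subrr add0r bnormN.
  exists (lam^-1 *: b).
  have -> : lam *: (1 : A) - V h = lam *: (1 - w).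
    by rewrite scalerBr scalerA mulfV// scale1r.
  rewrite -!bop_scaleAl -!bop_scaleAr !scalerA bl br mulfV// mulVf//.
  rewrite scale1r; split=> //; rewrite bnormZ normcV ler_wpM2l ?invr_ge0 ?(ltW r0)//.
  rewrite (le_trans bS)// ler_pM2l//.
  apply: bnorm_sum => i; rewrite (le_trans (bnormX _ _))//.
  rewrite lerXn2r ?nnegrE ?bnorm_ge0 ?mulr_ge0 ?invr_ge0 ?(ltW r0)//.
  by rewrite bnormZ normcV ler_wpM2l ?invr_ge0 ?(ltW r0).
move=> /resolvent_setP[M]; rewrite scale0r.
have M0 : 0 < `|M| + 1 by rewrite ltr_wpDl.
(* Since [e * (|M| + 1) = 1 / 2], an inverse bounded by [M] would force [1 <= 2 ^ - n] with
   [n > 0]. *)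
pose e := (2 * (`|M| + 1))^-1.
have e0 : 0 < e by rewrite invr_gt0 mulr_gt0.
move=> inv; have [n n0 Vn] := qn e e0.
have near_both : \forall h \near (0 : R)^'+,
    bounded_inverse M (0 - V h) /\ bnorm (V h ^+ n) <= e ^+ n.
  exact: filterI inv Vn.
have [h [[g [gl gr gM]] Vnh]] := @filter_ex _ _ (at_right_proper_filter 0) _ near_both.
rewrite add0r in gl gr.
have Vg : V h ^+ n * (- g) ^+ n = 1.
  have Vg1 : V h * - g = 1 by rewrite mulrN -mulNr.
  have gV1 : - g * V h = 1 by rewrite mulNr -mulrN.
  by rewrite -exprMn_comm ?Vg1 ?expr1n// /GRing.comm Vg1.
have : 1 <= (e * (`|M| + 1)) ^+ n.
  rewrite -[leLHS](bnorm1 hX) -Vg (le_trans (bnormM _ _))// exprMn.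
  rewrite ler_pM ?bnorm_ge0// (le_trans (bnormX _ _))// bnormN.
  rewrite lerXn2r ?nnegrE ?bnorm_ge0 ?(ltW M0)//.
  by rewrite (le_trans gM)// (le_trans (ler_norm M))// lerDl.
have -> : e * (`|M| + 1) = 2^-1 by rewrite /e invfM mulfVK// gt_eqF.
by apply/negP; rewrite -ltNge exprn_ilt1 ?invr_ge0 ?invf_lt1 ?ltr1n// -lt0n.
Qed.

End families.

Theorem theorem29 (R : realType) (X : completeNormedModType R[i])
    (hX : exists x : X, x != 0)
    (U : R -> X -> X) (hU : Cb U) :
  asymp_quasinilpotent U <-> spectrum U = [set 0].
Proof.
have [V [C [C0 UV]]] := Cb_lift hU; split.
  exact: asymp_quasinilpotent_spectrum C0 UV hX.
exact: spectrum_eq0_asymp_quasinilpotent C0 UV.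
Qed.
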